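(* Let $n\ge1$, let $H\in\mathbb{R}^{n\times n}$ be symmetric positive definite, $\theta^*\in\mathbb{R}^n$, $Q^*\in\mathbb{R}$ (all unknown), and let $Q_0\in\mathbb{R}$, $\alpha_0>0$. Given any $\sigma_0>0$, any integer $D_M\ge1$ and any positive tuning parameters $a_1,\dots,a_n,k,\lambda,\omega_h$ satisfying $$kH>\lambda I,\qquad\omega_h>2\lambda,$$ there exist sufficiently small tuning parameters $\varepsilon>0$ and $\omega_i=O(\sqrt\varepsilon)$, $i=1,\dots,n$, such that the unbiased extremum seeking estimation error system for $(\tilde\theta,\tilde\eta)$ defined in the context is exponentially stable; that is, there is $\varepsilon^*>0$ such that for every $\varepsilon\in(0,\varepsilon^*]$, with the frequencies $\omega_i$ given by the formula in the context, the estimation error system is exponentially stable.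
   Context: Notation: $|\cdot|$ is the Euclidean norm; $|x|_P^2=x^TPx$; $\lfloor\cdot\rfloor$ is the floor; time $j$ runs over nonnegative integers; matrix inequalities are in the sense of symmetric matrices. Map and measurements: $Q(\theta)=Q^*+\frac12|\theta-\theta^*|_H^2$ on $\mathbb{R}^n$. The delay $D(j)\in\mathbb{Z}$ is unknown, time-varying, with $0\le D(j)\le D_M$ for all $j\ge0$. Measurements: $y(j)=0$ for $0\le j<D_M$, $y(j)=Q(\theta(j-D(j)))$ for $j\ge D_M$. Dithers: $T=\max\{nD_M\lfloor1/\sqrt\varepsilon\rfloor,\,2n+1\}$, $\omega_i=2\pi i/T$ (so $\omega_i=O(\sqrt\varepsilon)$ as $\varepsilon\to0$), $S(j)$ has components $S_i(j)=a_i\sin(\omega_ij)$, $M(j)$ has components $M_i(j)=\frac{2}{a_i}\sin(\omega_ij)$, $\alpha(j)=\alpha_0(1-\varepsilon\lambda)^j$. Algorithm: $\hat\theta(j)=\theta(0)$ for $0\le j\le D_M$ and $\hat\theta(j+1)=\hat\theta(j)-\varepsilon\frac{kM(j)}{\alpha(j)}[y(j)-\eta(j)]$ for $j\ge D_M$; $\eta(D_M)=Q_0$ and $\eta(j+1)=\eta(j)+\varepsilon\omega_h[y(j)-\eta(j)]$ for $j\ge D_M$. Input: $\theta(j)=\theta(0)$ for $0\le j\le D_M$, $\theta(j)=\hat\theta(j)+\alpha(j)S(j)$ for $j>D_M$. Estimation error system: $\tilde\theta(j)=\hat\theta(j)-\theta^*$ ($j\ge0$), $\tilde\eta(j)=\eta(j)-Q^*$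 ($j\ge D_M$). Thus $\tilde\theta(j)=\theta(0)-\theta^*$ for $0\le j\le D_M$, $\tilde\eta(D_M)=Q_0-Q^*$, and for $j\ge D_M$: $\tilde\theta(j+1)=\tilde\theta(j)-\varepsilon\frac{kM(j)}{\alpha(j)}[y(j)-Q^*-\tilde\eta(j)]$, $\tilde\eta(j+1)=\tilde\eta(j)-\varepsilon\omega_h[\tilde\eta(j)-y(j)+Q^*]$. Exponentially stable (semi-globally, with respect to $\sigma_0$) means: there exist $C>0$ and $r\in(0,1)$ such that $|\tilde\theta(j)|\le Cr^j$ and $|\tilde\eta(j)|\le Cr^j$ for all $j\ge D_M$, for every initial value with $|\theta(0)-\theta^*|\le\sigma_0$ and every delay $D(\cdot)$ with $0\le D(j)\le D_M$. *)

(* Defs.v *)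
From HB Require Import structures.
From mathcomp Require Import all_boot all_order all_algebra.
From mathcomp Require Import all_classical all_reals all_analysis.
Set Implicit Arguments. Unset Strict Implicit. Unset Printing Implicit Defensive.
Import Order.TTheory GRing.Theory Num.Theory.
Import numFieldNormedType.Exports.
Local Open Scope ring_scope.

(* The library norm on matrices is the sup norm, so the Euclidean one is
   introduced here. *)
Definition enorm (R : realType) (n : nat) (x : 'cV[R]_n) : R :=
  Num.sqrt (\sum_(i < n) x i 0 ^+ 2).

Definition qform (R : realType) (n : nat) (P : 'M[R]_n) (x : 'cV[R]_n) : R :=
  (x^T *m P *m x) 0 0.

Definition posdef (R : realType) (n : nat) (P : 'M[R]_n) : Prop :=
  P^T = P /\ forall x : 'cV[R]_n, x != 0 -> 0 < qform P x.

Definition mx_gt (R : realType) (n : nat) (A B : 'M[R]_n) : Prop :=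
  posdef (A - B).

Definition quad_map (R : realType) (n : nat) (H : 'M[R]_n) (thetas : 'cV[R]_n)
    (Qs : R) (theta : 'cV[R]_n) : R :=
  Qs + 2^-1 * qform H (theta - thetas).

Definition dither_period (R : realType) (n DM : nat) (eps : R) : int :=
  Num.max (n%:Z * DM%:Z * Num.floor (1 / Num.sqrt eps)) (2 * n%:Z + 1).

(* The ordinal [i : 'I_n] stands for the one-based index [i.+1]. *)
Definition dither_freq (R : realType) (n DM : nat) (eps : R) (i : 'I_n) : R :=
  2 * pi * i.+1%:R / (dither_period n DM eps)%:~R.

Definition dither_S (R : realType) (n DM : nat) (a : 'I_n -> R) (eps : R)
    (j : nat) : 'cV[R]_n :=
  \col_i (a i * sin (dither_freq DM eps i * j%:R)).

Definition dither_M (R : realType) (n DM : nat) (a : 'I_n -> R) (eps : R)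
    (j : nat) : 'cV[R]_n :=
  \col_i (2 / a i * sin (dither_freq DM eps i * j%:R)).

Definition dither_gain (R : realType) (alpha0 lambda eps : R) (j : nat) : R :=
  alpha0 * (1 - eps * lambda) ^+ j.

(* [eta] is only meaningful from time [DM] on; its earlier values are left
   unconstrained.  Truncated subtraction is harmless in [es_y_delayed], since
   [D j <= DM <= j] for the delays considered. *)
Record es_trajectory (R : realType) (n : nat) (H : 'M[R]_n)
    (thetas : 'cV[R]_n) (Qs Q0 alpha0 : R) (DM : nat) (a : 'I_n -> R)
    (k lambda omegah eps : R) (D : nat -> nat)
    (theta thetahat : nat -> 'cV[R]_n) (y eta : nat -> R) : Prop :=
  ESTrajectory {
  es_y_init : forall j, (j < DM)%N -> y j = 0;
  es_y_delayed : forall j, (DM <= j)%N ->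
    y j = quad_map H thetas Qs (theta (j - D j)%N);
  es_thetahat_init : forall j, (j <= DM)%N -> thetahat j = theta 0%N;
  es_thetahat_step : forall j, (DM <= j)%N ->
    thetahat j.+1 = thetahat j -
      (eps * (k / dither_gain alpha0 lambda eps j) * (y j - eta j))
        *: dither_M DM a eps j;
  es_eta_init : eta DM = Q0;
  es_eta_step : forall j, (DM <= j)%N ->
    eta j.+1 = eta j + eps * omegah * (y j - eta j);
  es_theta_init : forall j, (j <= DM)%N -> theta j = theta 0%N;
  es_theta_dither : forall j, (DM < j)%N ->
    theta j = thetahat j +
      dither_gain alpha0 lambda eps j *: dither_S DM a eps j }.

(* [C] and [r] are uniform in the delay and in the initial value. *)
Definition es_exponentially_stable (R : realType) (n : nat) (H : 'M[R]_n)
    (thetas : 'cV[R]_n) (Qs Q0 alpha0 sigma0 : R) (DM : nat) (a : 'I_n -> R)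
    (k lambda omegah eps : R) : Prop :=
  exists C r : R, [/\ 0 < C, 0 < r < 1 &
    forall (D : nat -> nat) (theta thetahat : nat -> 'cV[R]_n)
        (y eta : nat -> R),
      (forall j, (D j <= DM)%N) ->
      es_trajectory H thetas Qs Q0 alpha0 DM a k lambda omegah eps D
        theta thetahat y eta ->
      enorm (theta 0%N - thetas) <= sigma0 ->
      let thetat j := thetahat j - thetas in
      let etat j := eta j - Qs in
      forall j, (DM <= j)%N ->
        enorm (thetat j) <= C * r ^+ j /\ `|etat j| <= C * r ^+ j].

(* Main.v *)
Require Import Defs.
From HB Require Import structures.
From mathcomp Require Import all_boot all_order all_algebra.
From mathcomp Require Import all_classical all_reals all_analysis.
From mathcomp Require Import ring lra zify.
Import Order.TTheory GRing.Theory Num.Theory.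
Import numFieldNormedType.Exports.
Local Open Scope classical_set_scope.
Local Open Scope ring_scope.

(* Divide out the decay of the dither amplitude: with alpha = alpha0 beta^j and
   beta = 1 - eps lambda, put z = thetat / alpha and xi = etat / alpha^2.  In
   these variables the dithers have constant amplitude, and it suffices to show
   that z and xi stay bounded.  For xi this is a one-step estimate, since the gain
   (1 - eps omegah) / beta^2 is below 1 - eps (omegah - 2 lambda).  For z, one
   looks at a whole period T of the dithers, with T of order 1 / sqrt eps: there
   z moves by O(sqrt eps), so that up to a relative error O(sqrt eps) the
   increment of z is the exact sum over the period of the dynamics frozen at the
   start of it.  By the orthogonality and the oddness of the dithers that sum is
   - eps T (k H - lambda I) z, which contracts the Euclidean norm; the sphere on
   which this contraction beats the error is never crossed. *)

(** * Sums of trigonometric functions over a period *)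

Lemma periodic_window_sum (V : zmodType) (f : nat -> V) (T t : nat) :
  (forall j, f (j + T)%N = f j) ->
  \sum_(j < T) f (t + j)%N = \sum_(j < T) f j.
Proof.
move=> fT; elim: t => [|t IH]; first by apply: eq_bigr => j _; rewrite add0n.
rewrite -IH; apply: (addIr (f t)).
have -> : f t = f (t + 0)%N by rewrite addn0.
transitivity (\sum_(j < T.+1) f (t + j)%N).
  by rewrite big_ord_recl addrC; congr (_ + _); apply: eq_bigr => j _;
     rewrite /= addSnnS.
by rewrite big_ord_recr /= fT addn0.
Qed.

(** The reflection [j -> T - j] reverses the sign of each term, so the sum equals its own
    opposite. *)
Lemma odd_periodic_window_sum (R : realType) (V : lmodType R) (f : nat -> V)
    (T t : nat) :
  (forall j, f (j + T)%N = f j) ->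
  (forall j, (j <= T)%N -> f (T - j)%N = - f j) ->
  \sum_(j < T) f (t + j)%N = 0.
Proof.
move=> fT fN; rewrite periodic_window_sum //.
set s := \sum_(j < T) f j.
suff sN : s = - s.
  have : 2%:R *: s = 0 by rewrite scaler_nat mulr2n {2}sN subrr.
  by move/eqP; rewrite scaler_eq0 pnatr_eq0 /= => /eqP.
(* The window is first moved to start at 1, so that reversing its indices produces [T - j] and not
   [T - 1 - j]. *)
rewrite {1}/s -(@periodic_window_sum _ _ _ 1) // (reindex_inj rev_ord_inj) /=.
rewrite /s -sumrN; apply: eq_bigr => j _.
by rewrite add1n -subSn // subSS fN // ltnW.
Qed.

Lemma sinB2pin (R : realType) (x : R) (m : nat) :
  sin (2 * pi * m%:R - x) = - sin x.
Proof.
rewrite -sinN -(periodicn (@sinD2pi R) m (- x)) addrC; congr (sin (_ + _)).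
by rewrite -[pi *+ 2 *+ m]mulr_natr -[pi *+ 2]mulr_natr; ring.
Qed.

Lemma sinD2pin (R : realType) (x : R) (m : nat) :
  sin (x + 2 * pi * m%:R) = sin x.
Proof. by rewrite -[in LHS](opprK x) addrC sinB2pin sinN opprK. Qed.

(** After multiplication by [sin (w / 2)], with [w] the frequency, the sum telescopes over a whole
    number of turns; [0 < p < T] makes this factor positive. *)
Lemma cos_window_sum (R : realType) (T t p : nat) : (0 < p < T)%N ->
  \sum_(j < T) cos (2 * pi * p%:R / T%:R * (t + j)%:R) = 0 :> R.
Proof.
move=> /andP[p0 pT]; set w : R := 2 * pi * p%:R / T%:R.
have T0 : 0 < T%:R :> R by rewrite ltr0n (ltn_trans p0).
have s0 : 0 < sin (w / 2).
  apply: sin_gt0_pi; rewrite /w.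
  have -> : 2 * pi * p%:R / T%:R / 2 = pi * (p%:R / T%:R) :> R by field; lra.
  have pT0 : 0 < p%:R / T%:R :> R by rewrite divr_gt0 // ltr0n.
  rewrite (mulr_gt0 (pi_gt0 R) pT0) /=.
  by rewrite gtr_pMr ?pi_gt0 // ltr_pdivrMr // mul1r ltr_nat.
apply: (mulfI (lt0r_neq0 s0)); rewrite mulr0 mulr_sumr.
pose F j : R := sin (w * (t + j)%:R - w / 2) / 2.
rewrite (eq_bigr (fun j : 'I_T => F j.+1 - F j)); last first.
  move=> j _; rewrite /F.
  have -> : w * (t + j.+1)%:R - w / 2 = w * (t + j)%:R + w / 2.
    by rewrite addnS -natr1; field.
  rewrite sinD sinB; lra.
rewrite -(big_mkord xpredT (fun j => F j.+1 - F j)) telescope_sumr // /F.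
rewrite addn0 natrD mulrDr.
have -> : w * T%:R = 2 * pi * p%:R by rewrite /w divfK // lt0r_neq0.
rewrite -addrA [_ + - (w / 2)]addrC addrA sinD2pin; exact: subrr.
Qed.

(** The product formula leaves cosines of frequencies [p - q] and [p + q]; as [p + q < T], neither
    aliases to a constant unless [p = q], and then the mean 1/2 remains. *)
Lemma sin_window_orth (R : realType) (T t p q : nat) :
  (0 < p)%N -> (0 < q)%N -> (p + q < T)%N ->
  \sum_(j < T) sin (2 * pi * p%:R / T%:R * (t + j)%:R)
             * sin (2 * pi * q%:R / T%:R * (t + j)%:R)
  = (if p == q then T%:R / 2 else 0) :> R.
Proof.
wlog qp : p q / (q <= p)%N => [hw p0 q0 pqT|p0 q0 pqT].
  have [qp|pq] := leqP q p; first exact: hw.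
  rewrite eq_sym -hw ?(ltnW pq) // 1?addnC //.
  by apply: eq_bigr => j _; rewrite mulrC.
rewrite (eq_bigr (fun j : 'I_T =>
   (cos (2 * pi * (p - q)%:R / T%:R * (t + j)%:R)
  - cos (2 * pi * (p + q)%:R / T%:R * (t + j)%:R)) / 2)); last first.
  move=> j _; rewrite natrB // (natrD _ p); set x : R := (t + j)%:R.
  set c : R := 2 * pi.
  rewrite (_ : c * (p%:R - q%:R) / _ * x
             = c * p%:R / T%:R * x - c * q%:R / T%:R * x); last by ring.
  rewrite (_ : c * (p%:R + q%:R) / _ * x
             = c * p%:R / T%:R * x + c * q%:R / T%:R * x); last by ring.
  by rewrite cosB cosD; lra.
rewrite -mulr_suml sumrB [X in _ - X]cos_window_sum ?addn_gt0 ?p0 // subr0.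
case: eqVneq => [->|npq].
  rewrite subnn mulr0 mul0r; under eq_bigr do rewrite mul0r cos0.
  by rewrite sumr_const card_ord.
rewrite cos_window_sum ?mul0r // subn_gt0 ltn_neqAle eq_sym npq qp /=.
by rewrite (leq_ltn_trans (leq_subr _ _)) // (leq_ltn_trans (leq_addr q _)).
Qed.

(** * Sup norm, quadratic forms and coercivity *)

Lemma sin_lipschitz (R : realType) (x y : R) : `|sin x - sin y| <= `|x - y|.
Proof.
wlog xy : x y / x <= y.
  move=> hw; have [/hw//|/ltW/hw] := leP x y.
  by rewrite distrC [leRHS]distrC.
have [c _ E] := @MVT_segment R sin cos x y xy
  (fun u _ => is_derive_sin u) (continuous_subspaceT (@continuous_sin R)).
by rewrite distrC [leRHS]distrC E normrM ler_piMl // cos_max.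
Qed.

Lemma mx_norm_coef (R : realType) (m n : nat) (A : 'M[R]_(m, n)) i j :
  `|A i j| <= `|A|.
Proof.
by rewrite [leRHS]/Num.Def.normr /= mx_normrE; apply: (le_bigmax _ _ (i, j)).
Qed.

Lemma mx_norm_le (R : realType) (m n : nat) (A : 'M[R]_(m, n)) (c : R) :
  0 <= c -> (forall i j, `|A i j| <= c) -> `|A| <= c.
Proof.
move=> c0 Ac; rewrite [leLHS]/Num.Def.normr /= mx_normrE.
by apply: bigmax_le => // -[i j] _ /=; exact: Ac.
Qed.

Definition bform (R : realType) (n : nat) (P : 'M[R]_n) (x y : 'cV[R]_n) : R :=
  (x^T *m P *m y) 0 0.
Arguments bform {R n} P x y.

(** The entrywise l1 norm: paired with the sup norm of vectors, it bounds both [bform] and the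
    matrix-vector product. *)
Definition mxl1 (R : realType) (n : nat) (P : 'M[R]_n) : R :=
  \sum_i \sum_j `|P i j|.
Arguments mxl1 {R n} P.

Lemma mxl1_ge0 (R : realType) (n : nat) (P : 'M[R]_n) : 0 <= mxl1 P.
Proof. by apply: sumr_ge0 => i _; apply: sumr_ge0. Qed.

Lemma bformDl (R : realType) (n : nat) (P : 'M[R]_n) x y z :
  bform P (x + y) z = bform P x z + bform P y z.
Proof. by rewrite /bform linearD !mulmxDl mxE. Qed.

Lemma bformDr (R : realType) (n : nat) (P : 'M[R]_n) x y z :
  bform P x (y + z) = bform P x y + bform P x z.
Proof. by rewrite /bform mulmxDr mxE. Qed.

Lemma bformZl (R : realType) (n : nat) (P : 'M[R]_n) c x y :
  bform P (c *: x) y = c * bform P x y.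
Proof. by rewrite /bform linearZ -!scalemxAl mxE. Qed.

Lemma bformZr (R : realType) (n : nat) (P : 'M[R]_n) c x y :
  bform P x (c *: y) = c * bform P x y.
Proof. by rewrite /bform -scalemxAr mxE. Qed.

Lemma bformC (R : realType) (n : nat) (P : 'M[R]_n) x y :
  P^T = P -> bform P x y = bform P y x.
Proof.
move=> Ps; rewrite /bform.
have -> : (x^T *m P *m y) 0 0 = ((x^T *m P *m y)^T) 0 0 by rewrite [RHS]mxE.
by rewrite !trmx_mul trmxK Ps mulmxA.
Qed.

Lemma qformE (R : realType) (n : nat) (P : 'M[R]_n) x :
  qform P x = bform P x x.
Proof. by []. Qed.

Lemma qformZ (R : realType) (n : nat) (P : 'M[R]_n) c x :
  qform P (c *: x) = c ^+ 2 * qform P x.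
Proof. by rewrite !qformE bformZl bformZr mulrA. Qed.

Lemma qformD (R : realType) (n : nat) (P : 'M[R]_n) x y : P^T = P ->
  qform P (x + y) = qform P x + 2 * bform P x y + qform P y.
Proof.
move=> Ps; rewrite !qformE bformDl !bformDr (bformC _ _ _ y x) //; lra.
Qed.

Lemma normr_bform (R : realType) (n : nat) (P : 'M[R]_n) x y :
  `|bform P x y| <= mxl1 P * `|x| * `|y|.
Proof.
rewrite /bform mxE /mxl1 exchange_big !mulr_suml.
apply: le_trans (ler_norm_sum _ _ _) _; apply: ler_sum => j _.
rewrite normrM ler_pM // ?mx_norm_coef //.
rewrite mxE mulr_suml; apply: le_trans (ler_norm_sum _ _ _) _.
apply: ler_sum => i _.
by rewrite normrM mxE mulrC ler_wpM2l // mx_norm_coef.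
Qed.

Lemma normr_mulmx_cV (R : realType) (n : nat) (P : 'M[R]_n) (x : 'cV[R]_n) :
  `|P *m x| <= mxl1 P * `|x|.
Proof.
apply: mx_norm_le => [|i j]; first by rewrite mulr_ge0 ?mxl1_ge0.
rewrite mxE; apply: le_trans (ler_norm_sum _ _ _) _.
rewrite /mxl1 [X in _ <= X * _](bigD1 i) //= mulrDl.
apply: (@le_trans _ _ ((\sum_k `|P i k|) * `|x|)).
  rewrite mulr_suml; apply: ler_sum => k _.
  by rewrite normrM ler_wpM2l // mx_norm_coef.
by rewrite lerDl mulr_ge0 //; apply: sumr_ge0 => k _; apply: sumr_ge0.
Qed.

Lemma qform1E (R : realType) (n : nat) (x : 'cV[R]_n) :
  qform 1%:M x = \sum_i x i 0 ^+ 2.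
Proof.
rewrite /qform mulmx1 mxE; apply: eq_bigr => i _.
by rewrite mxE expr2.
Qed.

(** Passes from the Euclidean form, in which the contraction is stated, to the sup norm, in which
    errors are estimated. *)
Lemma sqr_mx_norm_le_qform1 (R : realType) (n : nat) (x : 'cV[R]_n) (r : R) :
  0 <= r -> qform 1%:M x <= r ^+ 2 -> `|x| <= r.
Proof.
move=> r0 xr; apply: mx_norm_le => // i j; rewrite (ord1 j).
rewrite -ler_sqr ?nnegrE //; apply: le_trans xr.
rewrite qform1E (bigD1 i) //= real_normK ?num_real // lerDl.
by apply: sumr_ge0 => k _; rewrite sqr_ge0.
Qed.

Lemma posdef_unitmx (R : realType) (n : nat) (P : 'M[R]_n) :
  posdef P -> P \in unitmx.
Proof.
move=> [_ Pp]; rewrite -row_free_unit; apply: inj_row_free => v vP.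
apply/eqP; apply: contraT => v0.
have : v^T != 0 by apply: contra_neq v0 => /(congr1 trmx); rewrite trmxK trmx0.
by move/Pp; rewrite /qform trmxK vP mul0mx mxE ltxx.
Qed.

Lemma posdef_ge0 (R : realType) (n : nat) (P : 'M[R]_n) x :
  posdef P -> 0 <= qform P x.
Proof.
move=> [_ Pp]; have [->|/Pp/ltW//] := eqVneq x 0.
by rewrite /qform mulmx0 mxE.
Qed.

(* Expanding [0 <= |x - t P^-1 x|_P^2] at [t = 1 / K], where [K] bounds the
   form of [P^-1], avoids both compactness and the spectral theorem. *)
Lemma posdef_coercive (R : realType) (n : nat) (P : 'M[R]_n) : posdef P ->
  exists2 mu : R, 0 < mu & forall x, mu * qform 1%:M x <= qform P x.
Proof.
move=> Pp; have Pu := posdef_unitmx _ _ _ Pp.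
pose K := mxl1 (invmx P) + 1.
have K0 : 0 < K by rewrite ltr_wpDl ?mxl1_ge0.
exists K^-1 => [|x]; first by rewrite invr_gt0.
set q := qform 1%:M x.
have q0 : 0 <= q by rewrite /q qform1E; apply: sumr_ge0 => i _; rewrite sqr_ge0.
pose y := invmx P *m x.
have Py : P *m y = x by rewrite mulmxA mulmxV // mul1mx.
have xy : bform P x y = q by rewrite /bform -mulmxA Py /q /qform mulmx1.
have yy : qform P y <= K * q.
  rewrite (_ : qform P y = bform (invmx P) x x); last first.
    have := bformC _ _ 1%:M x y (trmx1 _ _).
    by rewrite /bform /qform !mulmx1 -!mulmxA Py.
  apply: le_trans (ler_norm _) _; apply: le_trans (normr_bform _ _ _ _ _) _.
  have : `|x| ^+ 2 <= q.
    rewrite -[leRHS]sqr_sqrtr // ler_sqr ?nnegrE ?sqrtr_ge0 //.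
    by apply: sqr_mx_norm_le_qform1; rewrite ?sqrtr_ge0 // sqr_sqrtr.
  have := mxl1_ge0 _ _ (invmx P); rewrite /K; nra.
have := posdef_ge0 _ _ _ (x + (- K^-1) *: y) Pp.
rewrite qformD ?Pp.1 // bformZr xy qformZ sqrrN => h.
have : K^-1 ^+ 2 * qform P y <= K^-1 * q.
  rewrite (_ : K^-1 * q = K^-1 ^+ 2 * (K * q)); last by field; lra.
  by rewrite ler_wpM2l // sqr_ge0.
lra.
Qed.

(** Expand the square of [z + h w] with [w = e - P z]. By coercivity the cross term gains [2 h mu]
    times the squared Euclidean norm, and it loses [O(h d)] through [e]; the quadratic term is
    [O(h d)] since [h <= c * d]. For small [d] the gain wins on the sphere of radius [r]. *)
Lemma contraction_step (R : realType) (n : nat) (P : 'M[R]_n)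
    (mu h d r C c : R) (z e : 'cV[R]_n) :
  (forall x, mu * qform 1%:M x <= qform P x) ->
  0 <= h -> 0 <= d <= 1 -> 0 <= r -> 0 <= C -> 2 * h * mu <= 1 -> h <= c * d ->
  d * (2 * mxl1 (1%:M : 'M[R]_n) * r * C
       + c * mxl1 (1%:M : 'M[R]_n) * (C + mxl1 P * r) ^+ 2) <= 2 * mu * r ^+ 2 ->
  qform 1%:M z <= r ^+ 2 -> `|e| <= C * d ->
  qform 1%:M (z + h *: (e - P *m z)) <= r ^+ 2.
Proof.
move=> Pmu h0 /andP[d0 d1] r0 C0 hmu hc hd zr ed.
have zn := sqr_mx_norm_le_qform1 _ _ _ _ r0 zr.
set N := mxl1 (1%:M : 'M[R]_n) in hd *; set p := mxl1 P in hd *.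
have N0 : 0 <= N := mxl1_ge0 _ _ _; have p0 : 0 <= p := mxl1_ge0 _ _ _.
set w := e - P *m z.
rewrite qformD ?trmx1 // bformZr qformZ.
have zw : bform 1%:M z w <= N * r * (C * d) - mu * qform 1%:M z.
  rewrite /w bformDr (_ : bform 1%:M z (- (P *m z)) = - qform P z); last first.
    by rewrite /bform /qform mulmx1 mulmxN mxE mulmxA.
  apply: lerD; last by rewrite lerN2.
  apply: le_trans (ler_norm _) _; apply: le_trans (normr_bform _ _ _ _ _) _.
  by rewrite ler_pM // ?mulr_ge0 // ler_wpM2l.
have wn : `|w| <= C + p * r.
  apply: le_trans (ler_normB _ _) _; apply: lerD.
    by apply: le_trans ed _; rewrite ler_piMr.
  by apply: le_trans (normr_mulmx_cV _ _ _ _) _; rewrite ler_wpM2l.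
have ww : qform 1%:M w <= N * (C + p * r) ^+ 2.
  apply: le_trans (ler_norm _) _; apply: le_trans (normr_bform _ _ _ _ _) _.
  by rewrite -mulrA ler_wpM2l // ler_pM.
have h2 : h ^+ 2 * qform 1%:M w <= h * (d * (c * (N * (C + p * r) ^+ 2))).
  apply: (@le_trans _ _ (h ^+ 2 * (N * (C + p * r) ^+ 2))).
    by rewrite ler_wpM2l ?sqr_ge0.
  rewrite expr2 -mulrA ler_wpM2l // [leRHS]mulrA [d * c]mulrC ler_wpM2r //.
  by rewrite mulr_ge0 ?sqr_ge0.
have h1 : h * bform 1%:M z w <= h * (N * r * (C * d) - mu * qform 1%:M z).
  by rewrite ler_wpM2l.
have h3 : h * (d * (2 * N * r * C + c * N * (C + p * r) ^+ 2))
        <= h * (2 * mu * r ^+ 2) by rewrite ler_wpM2l.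
(* [2 * h * mu <= 1] makes this coefficient nonnegative, which carries the estimate from the sphere
   to the whole ball. *)
have h4 : (1 - 2 * h * mu) * qform 1%:M z <= (1 - 2 * h * mu) * r ^+ 2.
  by rewrite ler_wpM2l // subr_ge0.
lra.
Qed.

(** * Averaging of the dithers *)

Lemma dither_freqE (R : realType) (n DM T : nat) (eps : R) (i : 'I_n) :
  dither_period n DM eps = T%:Z ->
  dither_freq DM eps i = 2 * pi * i.+1%:R / T%:R.
Proof. by move=> hT; rewrite /dither_freq hT. Qed.

Lemma sin_dither_periodic (R : realType) (n DM T : nat) (eps : R) (i : 'I_n)
    (j : nat) : (0 < T)%N -> dither_period n DM eps = T%:Z ->
  sin (dither_freq DM eps i * (j + T)%:R) = sin (dither_freq DM eps i * j%:R).
Proof.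
move=> T0 hT; rewrite natrD mulrDr (dither_freqE _ _ _ _ _ _ hT).
by rewrite [X in _ + X]divfK ?sinD2pin // pnatr_eq0 -lt0n.
Qed.

Lemma sin_dither_odd (R : realType) (n DM T : nat) (eps : R) (i : 'I_n)
    (j : nat) : (0 < T)%N -> dither_period n DM eps = T%:Z -> (j <= T)%N ->
  sin (dither_freq DM eps i * (T - j)%:R) = - sin (dither_freq DM eps i * j%:R).
Proof.
move=> T0 hT jT; rewrite natrB // mulrBr (dither_freqE _ _ _ _ _ _ hT).
by rewrite [X in X - _]divfK ?sinB2pin // pnatr_eq0 -lt0n.
Qed.

Section dither_average.
Context (R : realType) (n DM T : nat) (a : 'I_n -> R) (eps : R).
Hypothesis hT : dither_period n DM eps = T%:Z.
Hypothesis nT : (n.*2 < T)%N.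
Hypothesis ha : forall i, 0 < a i.

Let T0 : (0 < T)%N. Proof. by rewrite (leq_ltn_trans _ nT). Qed.
Let S := dither_S DM a eps.
Let M := dither_M DM a eps.

Lemma dither_S_periodic j : S (j + T)%N = S j.
Proof. by apply/matrixP => i k; rewrite !mxE (sin_dither_periodic _ _ _ T). Qed.

Lemma dither_M_periodic j : M (j + T)%N = M j.
Proof. by apply/matrixP => i k; rewrite !mxE (sin_dither_periodic _ _ _ T). Qed.

Lemma dither_S_odd j : (j <= T)%N -> S (T - j)%N = - S j.
Proof.
by move=> jT; apply/matrixP => i k; rewrite !mxE (sin_dither_odd _ _ _ T) // mulrN.
Qed.

Lemma dither_M_odd j : (j <= T)%N -> M (T - j)%N = - M j.
Proof.
by move=> jT; apply/matrixP => i k; rewrite !mxE (sin_dither_odd _ _ _ T) // mulrN.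
Qed.

(** Over a period the matrices [M S^T] sum to [T] times the identity: the amplitudes [a i] and
    [2 / a i] compensate the mean 1/2 of a squared sine. *)
Lemma dither_demodulation (v : 'cV[R]_n) (t : nat) :
  \sum_(j < T) (\sum_q v q 0 * S (t + j)%N q 0) *: M (t + j)%N = T%:R *: v.
Proof.
apply/matrixP => i k; rewrite (ord1 k) summxE mxE.
transitivity (\sum_q v q 0 * a q * (2 / a i) *
   \sum_(j < T) sin (dither_freq DM eps q * (t + j)%:R)
              * sin (dither_freq DM eps i * (t + j)%:R)).
  under [RHS]eq_bigr do rewrite mulr_sumr.
  rewrite exchange_big; apply: eq_bigr => j _; rewrite mxE mulr_suml.
  by apply: eq_bigr => q _; rewrite !mxE; ring.
have orth q : \sum_(j < T) sin (dither_freq DM eps q * (t + j)%:R)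
              * sin (dither_freq DM eps i * (t + j)%:R)
            = if q == i then T%:R / 2 else 0.
  rewrite !(dither_freqE _ _ _ _ _ _ hT).
  rewrite sin_window_orth ?eqSS //.
  by rewrite (leq_ltn_trans _ nT) // -addnn leq_add.
rewrite (bigD1 i) //= orth eqxx big1 => [|q qi]; last first.
  by rewrite orth (negbTE qi) mulr0.
have := ha i; move=> ai; rewrite addr0; field; lra.
Qed.

(* The even part of the integrand in [S] is killed by the oddness of [M]. *)
Lemma dither_average (H : 'M[R]_n) (z : 'cV[R]_n) (x : R) (t : nat) : H^T = H ->
  \sum_(j < T) (2^-1 * qform H (z + S (t + j)%N) - x) *: M (t + j)%N
  = T%:R *: (H *m z).
Proof.
move=> Hs; rewrite -(dither_demodulation (H *m z) t).
apply/eqP; rewrite -subr_eq0 -sumrB; apply/eqP.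
pose f j := (2^-1 * (qform H z + qform H (S j)) - x) *: M j.
rewrite -[RHS](@odd_periodic_window_sum R _ f T t); last 2 first.
- by move=> j; rewrite /f dither_S_periodic dither_M_periodic.
- move=> j jT; rewrite /f dither_S_odd // dither_M_odd //.
  by rewrite -[- S j]scaleN1r qformZ sqrrN expr1n mul1r scalerN.
apply: eq_bigr => j _; rewrite -scalerBl /f; congr (_ *: _).
rewrite qformD // (_ : bform H z (S (t + j)%N)
                     = \sum_q (H *m z) q 0 * S (t + j)%N q 0); first by lra.
rewrite bformC // /bform -mulmxA mxE; apply: eq_bigr => q _.
by rewrite mxE mulrC.
Qed.

Lemma dither_S_le j : `|S j| <= \sum_i a i.
Proof.
apply: mx_norm_le => [|i k]; first by apply: sumr_ge0 => i _; exact/ltW.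
rewrite mxE normrM (gtr0_norm (ha i)) (bigD1 i) //=.
apply: (@le_trans _ _ (a i)); first by rewrite ler_piMr ?sin_max // ltW.
by rewrite lerDl; apply: sumr_ge0 => l _; exact/ltW.
Qed.

Lemma dither_M_le j : `|M j| <= \sum_i (2 / a i).
Proof.
have a2 i : 0 <= 2 / a i by rewrite divr_ge0 // ltW.
apply: mx_norm_le => [|i k]; first by apply: sumr_ge0.
rewrite mxE normrM (ger0_norm (a2 i)) (bigD1 i) //=.
apply: (@le_trans _ _ (2 / a i)); first by rewrite ler_piMr ?sin_max.
by rewrite lerDl; apply: sumr_ge0.
Qed.

(** No frequency exceeds [2 pi n / T], so the dithers hardly change over a delay when [T] is
    large. *)
Lemma dither_S_lipschitz i j : (i <= j)%N ->
  `|S i - S j| <= (\sum_i a i) * (2 * pi * n%:R / T%:R) * (j - i)%:R.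
Proof.
move=> ij; have s0 : 0 <= \sum_i a i by apply: sumr_ge0 => l _; exact/ltW.
have p0 := pi_ge0 R.
have w0 : 0 <= 2 * pi * n%:R / T%:R :> R by rewrite divr_ge0 ?mulr_ge0.
apply: mx_norm_le => [|l k]; first by rewrite !mulr_ge0.
rewrite !mxE -mulrBr normrM (gtr0_norm (ha l)) -mulrA.
apply: ler_pM => //; first exact: ltW.
  rewrite (bigD1 l) //= lerDl; apply: sumr_ge0 => m _; exact: ltW.
apply: le_trans (sin_lipschitz _ _ _) _.
rewrite -mulrBr normrM distrC -natrB // normr_nat ler_wpM2r //.
rewrite (dither_freqE _ _ _ _ _ _ hT) ger0_norm ?divr_ge0 ?mulr_ge0 //.
by rewrite ler_wpM2r // ler_wpM2l ?mulr_ge0 // ler_nat.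
Qed.

End dither_average.

(** * Boundedness of the scaled error *)

Lemma bernoulli_sub (R : realType) (x : R) (m : nat) : 0 <= x <= 1 ->
  1 - m%:R * x <= (1 - x) ^+ m.
Proof.
move=> /andP[x0 x1]; elim: m => [|m IH]; first by rewrite mul0r subr0 expr0.
rewrite exprS -natr1.
have : (1 - x) * (1 - m%:R * x) <= (1 - x) * (1 - x) ^+ m.
  by rewrite ler_wpM2l // subr_ge0.
have : 0 <= m%:R * x * x by rewrite !mulr_ge0.
lra.
Qed.

Ltac nonneg := repeat first
  [ by [] | exact: ltW | exact: pi_ge0 | exact: mxl1_ge0 | exact: sqr_ge0
  | apply: mulr_ge0 | apply: addr_ge0 ].

Section scaled_error.
Context (R : realType) (n : nat) (H : 'M[R]_n) (DM : nat) (a : 'I_n -> R).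
Context (k lambda omegah rho X mu : R).

(* As long as [|z| <= r] and [|xi| <= X], the scaled measurements are bounded by
   [G], [eps * K1] and [eps * K2] bound the increments of [z] and [xi], and, with
   [d = sqrt eps], [Cg * d] and [C * d] bound what is lost in the measurement and
   in the increment of [z / eps] by freezing [z] and [xi] over a period. *)
Let P := k *: H - lambda *: 1%:M.
Let r := rho + 1.
Let A := \sum_i a i.
Let Mb := \sum_i (2 / a i).
Let G := mxl1 H * (r + A) ^+ 2.
Let c := (n * DM)%:R : R.
Let K1 := 2 * lambda * r + 2 * k * (G + X) * Mb.
Let K2 := 4 * lambda * X + 2 * omegah * (G + X).
Let Cg := 2 * DM%:R * lambda * G
  + mxl1 H * (r + A) * (K1 * (c + DM%:R) + 4 * pi * n%:R * DM%:R * A).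
Let C := lambda * (2 * lambda * r + c * K1)
  + k * Mb * (2 * lambda * (G + X) + c * K2 + Cg).
Let N1 := mxl1 (1%:M : 'M[R]_n).
Let W := 2 * N1 * r * C + c * N1 * (C + mxl1 P * r) ^+ 2.

(* The argument works when [sqrt eps] is at most the inverse of this sum, each
   term of which accounts for one smallness requirement. *)
Definition smallness_threshold : R :=
  4 + 4 * DM%:R * lambda + omegah + (N1 + 1) * K1 * (c + DM%:R + 1)
    + 2 * c * mu + W / (2 * mu * r ^+ 2).

Hypothesis ha : forall i, 0 < a i.
Hypothesis k0 : 0 < k.
Hypothesis lambda0 : 0 < lambda.
Hypothesis omegah2 : 2 * lambda < omegah.
Hypothesis rho0 : 0 <= rho.
Hypothesis X0 : 0 <= X.
Hypothesis mu0 : 0 < mu.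

Let r0 : 0 <= r. Proof. by rewrite addr_ge0. Qed.
Let A0 : 0 <= A. Proof. by apply: sumr_ge0 => i _; exact: ltW. Qed.
Let Mb0 : 0 <= Mb.
Proof. by apply: sumr_ge0 => i _; rewrite divr_ge0 // ltW. Qed.
Let G0 : 0 <= G. Proof. by rewrite mulr_ge0 ?mxl1_ge0 // sqr_ge0. Qed.
Let c0 : 0 <= c. Proof. by []. Qed.
Let omegah0 : 0 < omegah.
Proof. by apply: lt_trans omegah2; rewrite mulr_gt0. Qed.
Let K10 : 0 <= K1. Proof. by rewrite /K1; nonneg. Qed.
Let K20 : 0 <= K2. Proof. by rewrite /K2; nonneg. Qed.
Let Cg0 : 0 <= Cg. Proof. by rewrite /Cg; nonneg. Qed.
Let C0 : 0 <= C. Proof. by rewrite /C; nonneg. Qed.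
Let N10 : 0 <= N1. Proof. exact: mxl1_ge0. Qed.
Let W0 : 0 <= W. Proof. by rewrite /W; nonneg. Qed.
Let mur0 : 0 < 2 * mu * r ^+ 2.
Proof.
have r_gt0 : 0 < r by rewrite ltr_wpDl.
by apply: mulr_gt0; rewrite ?exprn_gt0 // mulr_gt0.
Qed.

Let threshold_terms (t : R) : t \in
    [:: 4; 4 * DM%:R * lambda; omegah; (N1 + 1) * K1 * (c + DM%:R + 1);
        2 * c * mu; W / (2 * mu * r ^+ 2)] -> 0 <= t <= smallness_threshold.
Proof.
have t1 : 0 <= 4 * DM%:R * lambda by nonneg.
have t2 := ltW omegah0.
have t3 : 0 <= (N1 + 1) * K1 * (c + DM%:R + 1) by nonneg.
have t4 : 0 <= 2 * c * mu by nonneg.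
have t5 : 0 <= W / (2 * mu * r ^+ 2) by rewrite divr_ge0 // ltW.
rewrite !inE /smallness_threshold.
move=> /orP[/eqP->|/orP[/eqP->|/orP[/eqP->|/orP[/eqP->|/orP[/eqP->|/eqP->]]]]];
  lra.
Qed.

Lemma smallness_threshold_ge4 : 4 <= smallness_threshold.
Proof.
have := threshold_terms 4; rewrite inE eqxx => /(_ isT).
by move=> /andP[_ ?].
Qed.

Lemma smallness_threshold_gain : 4 * DM%:R * lambda <= smallness_threshold.
Proof.
have := threshold_terms (4 * DM%:R * lambda).
by rewrite !inE eqxx orbT => /(_ isT) /andP[_ ?].
Qed.

Context (T : nat) (eps d : R).
Context (D : nat -> nat) (z s : nat -> 'cV[R]_n) (xi g : nat -> R).
Hypothesis Hs : H^T = H.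
Hypothesis DM1 : (1 <= DM)%N.
Hypothesis epsE : eps = d ^+ 2.
Hypothesis d0 : 0 < d.
Hypothesis d_small : smallness_threshold * d <= 1.
Hypothesis hD : forall j, (D j <= DM)%N.
Hypothesis hT : dither_period n DM eps = T%:Z.
Hypothesis nT : (n.*2 < T)%N.
Hypothesis dT_le : d * T%:R <= (n * DM)%:R.
Hypothesis dT_ge : 1 <= 2 * d * T%:R.

Let b := 1 - eps * lambda.
Let S := dither_S DM a eps.
Let M := dither_M DM a eps.

Hypothesis hg : forall j, (DM <= j)%N -> g j =
  2^-1 * (b ^+ (2 * D j))^-1 * qform H (z (j - D j)%N + s (j - D j)%N).
Hypothesis hz : forall j, (DM <= j)%N ->
  z j.+1 = b^-1 *: (z j - (eps * k * (g j - xi j)) *: M j).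
Hypothesis hxi : forall j, (DM <= j)%N ->
  xi j.+1 = (b ^+ 2)^-1 * (xi j + eps * omegah * (g j - xi j)).
Hypothesis sS : forall j, (DM < j)%N -> s j = S j.
Hypothesis sA : forall j, `|s j| <= A.
Hypothesis z_init : forall j, (j <= DM)%N -> qform 1%:M (z j) <= rho ^+ 2.
Hypothesis xi_init : `|xi DM| <= X.
Hypothesis GX : omegah * G <= (omegah - 2 * lambda) * X.
Hypothesis Pmu : forall x, mu * qform 1%:M x <= qform P x.

Let d_small_term (t : R) : t \in
    [:: 4; 4 * DM%:R * lambda; omegah; (N1 + 1) * K1 * (c + DM%:R + 1);
        2 * c * mu; W / (2 * mu * r ^+ 2)] -> t * d <= 1.
Proof.
move=> /threshold_terms/andP[_ tk]; apply: le_trans d_small.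
by rewrite ler_wpM2r // ltW.
Qed.

Let small_lambda : 4 * DM%:R * lambda * d <= 1.
Proof. by apply: d_small_term; rewrite !inE eqxx ?orbT. Qed.
Let small_omegah : omegah * d <= 1.
Proof. by apply: d_small_term; rewrite !inE eqxx ?orbT. Qed.
Let small_transient : (N1 + 1) * K1 * (c + DM%:R + 1) * d <= 1.
Proof. by apply: d_small_term; rewrite !inE eqxx ?orbT. Qed.
Let small_mu : 2 * c * mu * d <= 1.
Proof. by apply: d_small_term; rewrite !inE eqxx ?orbT. Qed.
Let small_window : d * W <= 2 * mu * r ^+ 2.
Proof.
rewrite -[leRHS]mul1r -ler_pdivrMr // [d * W]mulrC mulrAC.
by apply: d_small_term; rewrite !inE eqxx ?orbT.
Qed.
Let d01 : 0 < d <= 1.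
Proof.
rewrite d0 /=; have : 4 * d <= 1 by apply: d_small_term; rewrite !inE eqxx.
by apply: le_trans; rewrite ler_peMl ?ler1n // ltW.
Qed.

Let eps0 : 0 < eps. Proof. by rewrite epsE exprn_gt0. Qed.
Let eps_d : eps <= d.
Proof. by rewrite epsE expr2 ler_piMr ?(ltW d0) //; case/andP: d01. Qed.
Let epsT : eps * T%:R <= c * d.
Proof. by rewrite epsE expr2 -mulrA mulrC ler_wpM2r // ltW. Qed.

Let lambda_eps : 4 * DM%:R * lambda * eps <= 1.
Proof.
apply: le_trans small_lambda; rewrite ler_wpM2l //.
by rewrite !mulr_ge0 // ltW.
Qed.

Let lambda_eps4 : 4 * (eps * lambda) <= 1.
Proof.
apply: le_trans lambda_eps; rewrite [eps * _]mulrC mulrA ler_wpM2r ?(ltW eps0) //.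
by rewrite ler_wpM2r ?(ltW lambda0) // ler_peMr // ler1n.
Qed.

Let epslambda0 : 0 < eps * lambda. Proof. by rewrite mulr_gt0. Qed.
Let b0 : 0 < b. Proof. by have := lambda_eps4; rewrite /b; lra. Qed.
Let bV1 : 1 <= b^-1. Proof. by have := epslambda0; rewrite invf_ge1 // /b; lra. Qed.
Let bVle : b^-1 <= 1 + 2 * (eps * lambda).
Proof.
rewrite -[b^-1]mul1r ler_pdivrMr // /b.
have : 0 <= (eps * lambda) * (1 - 4 * (eps * lambda)).
  by rewrite mulr_ge0 ?subr_ge0 // ltW.
nra.
Qed.
Let bV2 : b^-1 <= 2. Proof. by have := bVle; have := lambda_eps4; lra. Qed.
Let bVn : `|b^-1| <= 2. Proof. by rewrite gtr0_norm ?invr_gt0. Qed.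
Let b2 : 2^-1 <= b ^+ 2.
Proof.
have e4 := lambda_eps4; have e0 := epslambda0.
by apply: (@le_trans _ _ (1 - 2%:R * (eps * lambda)));
  [lra | apply: bernoulli_sub; lra].
Qed.

(** The measurement is normalised by the current amplitude although its input was dithered with an
    earlier one; the resulting factor is [1 + O(eps)] by the Bernoulli inequality. *)
Let delay_gain j : 1 <= (b ^+ (2 * D j))^-1 <= 1 + 4 * DM%:R * lambda * eps.
Proof.
have e4 := lambda_eps4; have e0 := epslambda0.
have u1 : b ^+ (2 * D j) <= 1 by rewrite exprn_ile1 ?(ltW b0) // /b; lra.
have u2 : 1 - (2 * DM%:R) * (eps * lambda) <= b ^+ (2 * D j).
  apply: (@le_trans _ _ (1 - (2 * D j)%:R * (eps * lambda))).
    rewrite lerD2l lerN2 ler_wpM2r ?(ltW epslambda0) // natrM.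
    by rewrite ler_wpM2l // ler_nat.
  by apply: bernoulli_sub; lra.
have u0 : 0 < b ^+ (2 * D j) by rewrite exprn_gt0.
rewrite invf_ge1 // u1 /= -[_^-1]mul1r ler_pdivrMr //.
set u := b ^+ _ in u1 u2 u0 *.
have := lambda_eps; set q := DM%:R * (eps * lambda) => q1.
have q0 : 0 <= q by rewrite mulr_ge0 // ltW.
rewrite (_ : 4 * DM%:R * lambda * eps = 4 * q); last by rewrite /q; ring.
have q2 : 4 * q <= 1 by rewrite /q; lra.
have u3 : 1 - 2 * q <= u by rewrite /q; lra.
have : (1 + 4 * q) * (1 - 2 * q) <= (1 + 4 * q) * u by rewrite ler_wpM2l //; lra.
nra.
Qed.

Lemma qform_zs_le i : qform 1%:M (z i) <= r ^+ 2 ->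
  `|qform H (z i + s i)| <= G.
Proof.
move=> zi; apply: le_trans (normr_bform _ _ _ _ _) _; rewrite -mulrA.
have zr := sqr_mx_norm_le_qform1 _ _ _ _ r0 zi.
rewrite ler_wpM2l ?mxl1_ge0 // expr2.
have zs : `|z i + s i| <= r + A.
  by apply: le_trans (ler_normD _ _) _; rewrite lerD.
by rewrite ler_pM.
Qed.

(** * Increments and drifts while the bounds hold up to time [m] *)

Section up_to.
Context (m : nat).
Hypothesis IHz : forall i, (i <= m)%N -> qform 1%:M (z i) <= r ^+ 2.
Hypothesis IHxi : forall i, (DM <= i <= m)%N -> `|xi i| <= X.

Lemma z_norm i : (i <= m)%N -> `|z i| <= r.
Proof. by move/IHz; apply: sqr_mx_norm_le_qform1. Qed.

Lemma g_le j : (DM <= j <= m)%N -> `|g j| <= G.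
Proof.
move=> /andP[DMj jm]; rewrite hg // !normrM ger0_norm //.
have /andP[v1 v2] := delay_gain j.
rewrite (ger0_norm (le_trans ler01 v1)).
have q := qform_zs_le (j - D j) (IHz _ (leq_trans (leq_subr _ _) jm)).
rewrite -[leRHS]mul1r; apply: ler_pM => //; last by have := lambda_eps; lra.
by rewrite mulr_ge0 // (le_trans ler01 v1).
Qed.

Lemma gxi_le j : (DM <= j <= m)%N -> `|g j - xi j| <= G + X.
Proof.
by move=> jm; apply: le_trans (ler_normB _ _) _; rewrite lerD ?g_le ?IHxi.
Qed.

(** Dividing by the decaying amplitude produces the growth term in [lambda], through
    [b^-1 = 1 + eps lambda b^-1]; it becomes the [- lambda I] in [P], which [k H] has to
    dominate. *)
Lemma z_increment j : (DM <= j)%N -> z j.+1 - z j =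
  eps *: ((lambda * b^-1) *: z j - (k * b^-1 * (g j - xi j)) *: M j).
Proof.
move=> DMj; rewrite hz // scalerBr !scalerA.
rewrite (_ : b^-1 = 1 + eps * (lambda * b^-1)); last first.
  by rewrite /b; field; rewrite -/b lt0r_neq0.
apply/matrixP => i l; rewrite !mxE /b; field.
by rewrite -/b !lt0r_neq0.
Qed.

Lemma z_step j : (DM <= j <= m)%N -> `|z j.+1 - z j| <= eps * K1.
Proof.
move=> /andP[DMj jm]; rewrite z_increment // normrZ gtr0_norm //.
rewrite ler_wpM2l ?(ltW eps0) //.
apply: le_trans (ler_normB _ _) _; rewrite !normrZ; apply: lerD.
  apply: ler_pM => //; last exact: z_norm.
  by rewrite (gtr0_norm lambda0) [2 * lambda]mulrC ler_pM2l.
have Mj := dither_M_le _ _ DM a eps ha j.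
do 2?apply: ler_pM => //; last by apply: gxi_le; rewrite DMj.
by rewrite (gtr0_norm k0) [2 * k]mulrC ler_pM2l.
Qed.

Lemma xi_step j : (DM <= j <= m)%N -> `|xi j.+1 - xi j| <= eps * K2.
Proof.
move=> /[dup] jm /andP[DMj jm']; rewrite hxi //.
have xj := IHxi _ jm; have gj := gxi_le _ jm.
have v2 : (b ^+ 2)^-1 <= 2 by rewrite invf_ple ?posrE ?exprn_gt0 // ?invr_gt0.
have v0 : 0 < (b ^+ 2)^-1 by rewrite invr_gt0 exprn_gt0.
rewrite (_ : _ - xi j = eps * ((b ^+ 2)^-1 *
  (lambda * (1 + b) * xi j + omegah * (g j - xi j)))); last first.
  by rewrite /b; field; rewrite -/b lt0r_neq0.
rewrite normrM (gtr0_norm eps0) ler_wpM2l ?(ltW eps0) //.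
rewrite normrM (gtr0_norm v0).
rewrite (_ : K2 = 2 * (lambda * 2 * X + omegah * (G + X))); last first.
  by rewrite /K2; ring.
apply: ler_pM => //; first exact: ltW.
apply: le_trans (ler_normD _ _) _; rewrite !normrM; apply: lerD.
  apply: ler_pM => //; apply: ler_pM => //; first by rewrite gtr0_norm.
  by have e4 := lambda_eps4; have e0 := epslambda0; rewrite gtr0_norm /b; lra.
by rewrite (gtr0_norm omegah0) ler_wpM2l // ltW.
Qed.

(** Each increment is bounded through the state at its start and earlier ones, so bounds up to [m]
    control [z] up to [m.+1]. *)
Lemma z_drift i j : (DM <= i <= j)%N -> (j <= m.+1)%N ->
  `|z j - z i| <= eps * K1 * (j - i)%:R.
Proof.
move=> /andP[DMi]; elim: j => [|j IH].
  by rewrite leqn0 => /eqP -> _; rewrite subrr subnn mulr0 normr0.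
rewrite leq_eqVlt => /predU1P[-> _|]; first by rewrite subrr subnn mulr0 normr0.
rewrite ltnS => ij jm; rewrite subSn // -natr1 mulrDr mulr1.
rewrite -(subrKA (z j)) addrC; apply: le_trans (ler_normD _ _) _.
apply: lerD; first by apply: IH => //; exact: ltnW.
by apply: z_step; rewrite (leq_trans DMi ij) -ltnS.
Qed.

Lemma xi_drift i j : (DM <= i <= j)%N -> (j <= m.+1)%N ->
  `|xi j - xi i| <= eps * K2 * (j - i)%:R.
Proof.
move=> /andP[DMi]; elim: j => [|j IH].
  by rewrite leqn0 => /eqP -> _; rewrite subrr subnn mulr0 normr0.
rewrite leq_eqVlt => /predU1P[-> _|]; first by rewrite subrr subnn mulr0 normr0.
rewrite ltnS => ij jm; rewrite subSn // -natr1 mulrDr mulr1.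
rewrite -(subrKA (xi j)) addrC; apply: le_trans (ler_normD _ _) _.
apply: lerD; first by apply: IH => //; exact: ltnW.
by apply: xi_step; rewrite (leq_trans DMi ij) -ltnS.
Qed.

(** The interval of radius [X] is invariant: [(1 - eps omegah) X + eps omegah G <= (1 - 2 eps
    lambda) X <= b^2 X], the first inequality by [GX]. *)
Lemma xi_next : (DM <= m)%N -> `|xi m.+1| <= X.
Proof.
move=> DMm; rewrite hxi //.
have xm : `|xi m| <= X by apply: IHxi; rewrite DMm leqnn.
have gm : `|g m| <= G by apply: g_le; rewrite DMm leqnn.
have v0 : 0 < b ^+ 2 by rewrite exprn_gt0.
have oe : eps * omegah <= 1.
  by apply: le_trans small_omegah; rewrite mulrC ler_wpM2l // ltW.
rewrite normrM gtr0_norm ?invr_gt0 // mulrC ler_pdivrMr //.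
rewrite (_ : xi m + _ = (1 - eps * omegah) * xi m + eps * omegah * g m);
  last by ring.
apply: le_trans (ler_normD _ _) _; rewrite !normrM.
rewrite (ger0_norm (_ : 0 <= 1 - eps * omegah)) ?subr_ge0 //.
rewrite (gtr0_norm eps0) (gtr0_norm omegah0).
have h1 : (1 - eps * omegah) * `|xi m| <= (1 - eps * omegah) * X.
  by rewrite ler_wpM2l // subr_ge0.
have h2 : eps * omegah * `|g m| <= eps * (omegah * G).
  by rewrite -mulrA !ler_wpM2l // ltW.
have h3 : eps * (omegah * G) <= eps * ((omegah - 2 * lambda) * X).
  by rewrite ler_wpM2l // ltW.
have h4 : 0 <= (eps * lambda) ^+ 2 * X by rewrite mulr_ge0 ?sqr_ge0.
apply: le_trans (lerD h1 h2) _; rewrite /b; nra.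
Qed.

(** Until a full period beyond the delays is available, no averaging is used: in the [T + DM + 1]
    steps after [DM] the drift is [O(d)], and the margin [r = rho + 1] absorbs it. *)
Lemma z_next_transient : (DM <= m)%N -> (m.+1 <= DM.*2 + 1 + T)%N ->
  qform 1%:M (z m.+1) <= r ^+ 2.
Proof.
move=> DMm mT.
have z0 := z_init _ (leqnn DM).
have zn := sqr_mx_norm_le_qform1 _ _ _ _ rho0 z0.
have := z_drift DM m.+1; rewrite leqnn leqW // => /(_ isT (leqnn _)).
set w := z m.+1 - z DM => wn.
have -> : z m.+1 = z DM + w by rewrite /w addrC subrK.
have le : (m.+1 - DM)%:R <= T%:R + DM%:R + 1 :> R.
  by rewrite -natrD natr1 ler_nat; clear -mT; lia.
have w1 : `|w| <= K1 * (c + DM%:R + 1) * d.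
  apply: (le_trans wn); rewrite mulrAC mulrC -[leRHS]mulrA ler_wpM2l //.
  apply: (@le_trans _ _ (eps * (T%:R + DM%:R + 1))).
    by rewrite ler_wpM2l // ltW.
  have : eps * (DM%:R + 1) <= d * (DM%:R + 1) by rewrite ler_wpM2r // addr_ge0.
  by have := epsT; lra.
have w2 : (N1 + 1) * `|w| <= 1.
  by apply: le_trans small_transient; rewrite -!mulrA ler_wpM2l ?addr_ge0 // !mulrA.
rewrite qformD ?trmx1 //.
have h1 : bform 1%:M (z DM) w <= N1 * rho * `|w|.
  apply: le_trans (ler_norm _) _; apply: le_trans (normr_bform _ _ _ _ _) _.
  by rewrite ler_wpM2r // ler_wpM2l.
have h2 : qform 1%:M w <= N1 * `|w| * `|w|.
  by apply: le_trans (ler_norm _) _; exact: normr_bform.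
have w0 : 0 <= `|w| by [].
have nw : 0 <= N1 * `|w| by rewrite mulr_ge0.
(* The expansion is at most [rho^2 + 2 rho + 1], that is [r^2]. *)
have h3 : rho * (N1 * `|w|) <= rho * 1 by rewrite ler_wpM2l //; lra.
have h4 : N1 * `|w| * `|w| <= 1 * 1 by apply: ler_pM => //; lra.
rewrite /r; nra.
Qed.

(** * Contraction over one full period after the transient *)

Section window.
Context (t : nat).
Hypothesis DMt : (DM.*2 < t)%N.
Hypothesis mE : m.+1 = (t + T)%N.

Let DMlt : (DM < t)%N.
Proof. by apply: leq_ltn_trans DMt; rewrite -addnn leq_addr. Qed.
Let tm : (t <= m)%N.
Proof.
by rewrite -ltnS mE -[X in (X < _)%N]addn0 ltn_add2l (leq_ltn_trans _ nT).
Qed.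
Let T0 : 0 < T%:R :> R. Proof. by rewrite ltr0n (leq_ltn_trans _ nT). Qed.

(** Because [t] exceeds [2 DM], the delayed time exceeds [DM], where the dither is active and the
    drift bound holds. There [z] is at most [T + DM] steps of size [O(eps)] from [z t], and the
    dither is at most [DM] steps late at frequency [O(1 / T)]; both errors are [O(d)]. *)
Lemma delayed_input_error j : (t <= j <= m)%N ->
  `|z (j - D j)%N + s (j - D j)%N - (z t + S j)|
  <= (K1 * (c + DM%:R) + 4 * pi * n%:R * DM%:R * A) * d.
Proof.
move=> /andP[tj jm]; set i := (j - D j)%N.
have DMi : (DM < i)%N.
  rewrite ltn_subRL; apply: leq_ltn_trans (leq_trans DMt tj).
  by rewrite -addnn leq_add2r.
have ij : (i <= j)%N by exact: leq_subr.
have ji : (j <= i + DM)%N by rewrite addnC -leq_subLR leq_sub2l.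
rewrite opprD addrACA mulrDl; apply: le_trans (ler_normD _ _) _; apply: lerD.
  have dist : `|z i - z t| <= eps * K1 * (T%:R + DM%:R).
    (* The delayed time may precede the start of the window. *)
    have [ti|it] := leqP t i.
      apply: le_trans (z_drift t i _ _) _; first by rewrite (ltnW DMlt).
        by rewrite (leq_trans ij) // ltnW.
      rewrite ler_wpM2l ?mulr_ge0 ?(ltW eps0) // -natrD ler_nat leq_subLR.
      by rewrite addnA -mE (leq_trans ij) // (leq_trans jm) // leqW // leq_addr.
    rewrite distrC; apply: le_trans (z_drift i t _ _) _.
        by rewrite (ltnW DMi) ltnW.
      by rewrite leqW.
    rewrite ler_wpM2l ?mulr_ge0 ?(ltW eps0) // -natrD ler_nat leq_subLR.
    by rewrite (leq_trans tj) // (leq_trans ji) // leq_add2l leq_addl.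
  apply: (le_trans dist); rewrite mulrAC mulrC -mulrA ler_wpM2l //.
  have : eps * DM%:R <= d * DM%:R by rewrite ler_wpM2r.
  by have := epsT; lra.
rewrite sS //; apply: le_trans (dither_S_lipschitz _ _ _ _ _ _ hT ha _ _ ij) _.
have TV : T%:R^-1 <= 2 * d.
  by rewrite -[_^-1]mul1r ler_pdivrMr.
have jD : (j - i)%:R <= DM%:R :> R.
  by rewrite ler_nat leq_subLR.
rewrite (_ : 4 * pi * n%:R * DM%:R * A * d
           = (A * (2 * pi * n%:R * (2 * d))) * DM%:R); last by ring.
apply: ler_pM => //; first by nonneg; rewrite invr_ge0.
rewrite ler_wpM2l // ler_wpM2l //; by nonneg.
Qed.

(** Two errors arise: the delay gain differs from 1 by [O(eps)], and the argument of the quadratic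
    form is displaced by [O(d)]. *)
Lemma measurement_error j : (t <= j <= m)%N ->
  `|g j - 2^-1 * qform H (z t + S j)| <= Cg * d.
Proof.
move=> /[dup] tjm /andP[tj jm].
have DMj : (DM <= j)%N by rewrite (leq_trans _ tj) // ltnW.
rewrite hg //; set w := z _ + s _; set w' := z t + S j.
have wG : `|qform H w| <= G.
  by apply: qform_zs_le; apply: IHz; rewrite (leq_trans _ jm) ?leq_subr.
have wn : `|w| <= r + A.
  apply: le_trans (ler_normD _ _) _; apply: lerD => //.
  by apply: z_norm; rewrite (leq_trans _ jm) ?leq_subr.
have wn' : `|w'| <= r + A.
  apply: le_trans (ler_normD _ _) _; apply: lerD; first exact: z_norm.
  exact: dither_S_le.
have ww' : `|w - w'| <= _ := delayed_input_error j tjm.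
clearbody w w'.
have /andP[v1 v2] := delay_gain j; set v := _^-1 in v1 v2 *.
(* By symmetry of [H], a difference of two values of the form is the bilinear form of the sum and
   the difference of the arguments. *)
have -> : 2^-1 * v * qform H w - 2^-1 * qform H w' =
  2^-1 * (v - 1) * qform H w + 2^-1 * bform H (w + w') (w - w').
  rewrite bformDl !bformDr -[- w']scaleN1r !bformZr (bformC _ _ _ w' w) //.
  by rewrite !qformE; ring.
rewrite /Cg mulrDl; apply: le_trans (ler_normD _ _) _; apply: lerD.
  rewrite normrM ger0_norm; last by rewrite mulr_ge0 // subr_ge0.
  rewrite [leRHS]mulrAC; apply: ler_pM => //; first by rewrite mulr_ge0 // subr_ge0.
  have : DM%:R * lambda * eps <= DM%:R * lambda * d.
    by rewrite ler_wpM2l // mulr_ge0 // ltW.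
  lra.
rewrite normrM ger0_norm //.
apply: (@le_trans _ _ (2^-1 * (mxl1 H * (2 * (r + A)) *
   ((K1 * (c + DM%:R) + 4 * pi * n%:R * DM%:R * A) * d)))); last first.
  by rewrite le_eqVlt; apply/orP; left; apply/eqP; field.
rewrite ler_wpM2l //; apply: le_trans (normr_bform _ _ _ _ _) _.
apply: ler_pM => //; first by rewrite mulr_ge0 // mxl1_ge0.
  rewrite ler_wpM2l ?mxl1_ge0 //; apply: le_trans (ler_normD _ _) _; lra.
Qed.

(** The bounded vector is the increment at [j] divided by [eps], minus the same with [b^-1] replaced
    by 1 and [z], [xi] frozen at [t], the dithers being kept at [j]. The contributions match the
    summands of [C] in order. *)
Lemma window_error j : (t <= j <= m)%N ->
  `|lambda *: (b^-1 *: z j - z t)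
    - (k * (b^-1 * (g j - xi j) - (2^-1 * qform H (z t + S j) - xi t))) *: M j|
  <= C * d.
Proof.
move=> /[dup] tjm /andP[tj jm].
have DMj : (DM <= j)%N by rewrite (leq_trans _ tj) // ltnW.
have jt : (j - t)%:R <= T%:R :> R.
  by rewrite ler_nat leq_subLR -mE (leq_trans jm).
have b1 : `|b^-1 - 1| <= 2 * lambda * d.
  rewrite ger0_norm ?subr_ge0 //.
  have := bVle; have : lambda * eps <= lambda * d by rewrite ler_wpM2l // ltW.
  lra.
(* A drift over at most [T] steps is [O(d)] because [eps T <= c d]. *)
have drift K x : 0 <= K -> x <= eps * K * (j - t)%:R -> x <= c * K * d.
  move=> K0 xK; apply: (le_trans xK).
  apply: (@le_trans _ _ (eps * K * T%:R)).
    by rewrite ler_wpM2l // mulr_ge0 // ltW.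
  by rewrite [leLHS]mulrAC [leRHS]mulrAC ler_wpM2r.
have jDM : (DM <= t <= j)%N by rewrite ltnW.
have zd := drift _ _ K10 (z_drift t j jDM (leqW jm)).
have xd := drift _ _ K20 (xi_drift t j jDM (leqW jm)).
rewrite /C mulrDl; apply: le_trans (ler_normB _ _) _; apply: lerD.
  rewrite normrZ (gtr0_norm lambda0) -mulrA ler_wpM2l ?(ltW lambda0) //.
  rewrite (_ : _ - z t = (b^-1 - 1) *: z j + (z j - z t)); last first.
    by rewrite scalerBl scale1r addrA subrK.
  rewrite mulrDl; apply: le_trans (ler_normD _ _) _; apply: lerD => //.
  by rewrite normrZ [leRHS]mulrAC; apply: ler_pM => //; exact: z_norm.
rewrite normrZ normrM (gtr0_norm k0) -[leLHS]mulrA -2![leRHS]mulrA.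
rewrite ler_wpM2l ?(ltW k0) //.
rewrite mulrC; apply: ler_pM => //; first exact: dither_M_le.
rewrite (_ : _ - (_ - _) = (b^-1 - 1) * (g j - xi j) - (xi j - xi t)
   + (g j - 2^-1 * qform H (z t + S j))); last by ring.
rewrite [leRHS]mulrDl; apply: le_trans (ler_normD _ _) _; apply: lerD; last first.
  exact: measurement_error.
rewrite [leRHS]mulrDl; apply: le_trans (ler_normB _ _) _; apply: lerD => //.
by rewrite normrM [leRHS]mulrAC; apply: ler_pM => //; apply: gxi_le; rewrite DMj.
Qed.

Lemma z_next_window : qform 1%:M (z m.+1) <= r ^+ 2.
Proof.
pose F j := lambda *: z t - k *: ((2^-1 * qform H (z t + S j) - xi t) *: M j).
pose e j := lambda *: (b^-1 *: z j - z t)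
  - (k * (b^-1 * (g j - xi j) - (2^-1 * qform H (z t + S j) - xi t))) *: M j.
have inc j : (t <= j)%N -> z j.+1 - z j = eps *: (F j + e j).
  move=> tj; rewrite z_increment; last by rewrite (leq_trans _ tj) // ltnW.
  by congr (_ *: _); apply/matrixP => p q; rewrite !mxE; ring.
pose E := T%:R^-1 *: \sum_(j < T) e (t + j)%N.
(* Exact averaging: the measurement term contributes [- k T H z t], while the constant [xi t]
   multiplies dithers of zero sum. *)
have FE : \sum_(j < T) F (t + j)%N = - (T%:R *: (P *m z t)).
  rewrite /F sumrB sumr_const card_ord -scaler_sumr dither_average //.
  rewrite -scaler_nat mulmxBl -!scalemxAl mul1mx.
  by apply/matrixP => p q; rewrite !mxE; ring.
(* Over the window [z] makes one step of length [eps T] along [- P z t], perturbed by the mean error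
   [E]. *)
have -> : z m.+1 = z t + (eps * T%:R) *: (E - P *m z t).
  have -> : z m.+1 = z t + \sum_(j < T) (z (t + j).+1 - z (t + j)%N).
    rewrite mE -(big_mkord xpredT (fun j => z (t + j).+1 - z (t + j)%N)).
    rewrite (eq_bigr (fun j => z (t + j.+1)%N - z (t + j)%N)); last first.
      by move=> j _; rewrite addnS.
    by rewrite (telescope_sumr (fun j => z (t + j)%N)) // addn0 addrC subrK.
  congr (_ + _).
  rewrite (eq_bigr (fun j : 'I_T => eps *: (F (t + j)%N + e (t + j)%N))).
    rewrite -scaler_sumr big_split /= FE -scalerA; congr (_ *: _).
    by rewrite /E scalerBr scalerA divff ?lt0r_neq0 // scale1r addrC.
  by move=> j _; rewrite inc // leq_addr.
apply: (@contraction_step _ _ _ mu _ d r C c) => //.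
- by rewrite mulr_ge0 // ltW.
- by case/andP: d01 => /ltW -> ->.
- have : mu * (eps * T%:R) <= mu * (c * d) by rewrite ler_wpM2l // ltW.
  by have := small_mu; lra.
- exact: IHz.
rewrite normrZ gtr0_norm ?invr_gt0 // mulrC ler_pdivrMr //.
apply: le_trans (ler_norm_sum _ _ _) _.
apply: (@le_trans _ _ (\sum_(j < T) C * d)); last first.
  by rewrite sumr_const card_ord mulr_natr.
apply: ler_sum => j _; apply: window_error.
by rewrite leq_addr -ltnS mE ltn_add2l /=.
Qed.

End window.

End up_to.
(* The window of length [T] ending at [m.+1] may start at any time after the
   transient, so a single strong induction over time suffices. *)
Lemma scaled_error_bounded m :
  (forall i, (i <= m)%N -> qform 1%:M (z i) <= r ^+ 2) /\
  (forall i, (DM <= i <= m)%N -> `|xi i| <= X).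
Proof.
elim: m => [|m [IHz IHxi]].
  split=> i; rewrite leqn0.
    move=> /eqP ->; apply: le_trans (z_init _ (leq0n _)) _.
    by rewrite ler_sqr ?nnegrE // /r lerDl.
  (* The range for [xi] is empty at time 0, as [DM] is positive. *)
  by move=> /andP[DMi /eqP i0]; move: DMi DM1; rewrite i0 leqn0 => /eqP ->.
split=> i.
  rewrite leq_eqVlt ltnS => /predU1P[->|/IHz//].
  have [DMm|mDM] := leqP DM m; last first.
    apply: le_trans (z_init _ mDM) _.
    by rewrite ler_sqr ?nnegrE // /r lerDl.
  (* Beyond this time the window of length [T] ending at [m.+1] starts after [2 DM], as the
     averaging requires. *)
  have [mT|Tm] := leqP m.+1 (DM.*2 + 1 + T); first exact: (z_next_transient m).
  apply: (z_next_window m IHz IHxi (m.+1 - T)).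
    rewrite ltn_subRL addnC; apply: ltn_trans Tm.
    by rewrite -addnA [(1 + T)%N]addnC addnA addn1.
  rewrite subnK //; apply: leq_trans (ltnW Tm); exact: leq_addl.
move=> /andP[DMi]; rewrite leq_eqVlt ltnS => /predU1P[iE|im]; last first.
  by apply: IHxi; rewrite DMi.
move: DMi; rewrite iE leq_eqVlt ltnS => /predU1P[<-//|DMm].
exact: (xi_next m).
Qed.

End scaled_error.

Arguments smallness_threshold {R n} H DM a k lambda omegah rho X mu.

(** * Trajectories of the extremum seeking algorithm *)

Lemma enormE (R : realType) (n : nat) (x : 'cV[R]_n) :
  enorm x = Num.sqrt (qform 1%:M x).
Proof. by rewrite qform1E. Qed.

(** For [d <= 1/4] the floor [q] of [1 / d] is at least 3, so [n DM q >= 2 n + 1] and the maximum is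
    its first argument. The last two bounds come from [1 - d <= q d <= 1]. *)
Lemma dither_period_large (R : realType) (n DM : nat) (d : R) :
  (1 <= n)%N -> (1 <= DM)%N -> 0 < d -> 4 * d <= 1 ->
  exists T : nat, [/\ dither_period n DM (d ^+ 2) = T%:Z, (n.*2 < T)%N,
    d * T%:R <= (n * DM)%:R & 1 <= 2 * d * T%:R].
Proof.
move=> n1 DM1 d0 d4; rewrite /dither_period sqrtr_sqr gtr0_norm // div1r.
have dV4 : 4 <= d^-1 by rewrite -[d^-1]mul1r ler_pdivlMr.
have [f1 f2] : (Num.floor d^-1)%:~R <= d^-1 /\ d^-1 < (Num.floor d^-1)%:~R + 1.
  by have /andP[-> +] := floor_itv d^-1; rewrite intrD.
have : 3%:Z <= Num.floor d^-1.
  by rewrite floor_ge_int; apply: le_trans dV4; rewrite ler_nat.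
move: f1 f2; case: (Num.floor _) => // q f1 f2 q3.
have {}q3 : (3 <= q)%N by [].
exists (n * DM * q)%N.
have nDM : (n <= n * DM)%N by rewrite leq_pmulr.
have nq : (n * 3 <= n * DM * q)%N by rewrite leq_mul.
have qd : q%:R * d <= 1 by rewrite -ler_pdivlMr // div1r.
have qd2 : 1 <= (q%:R + 1) * d by rewrite -ler_pdivrMr // div1r ltW.
split.
- by rewrite max_l // -!PoszM; lia.
- by lia.
- rewrite (natrM _ (n * DM)) mulrC -mulrA.
  by rewrite ler_piMr.
have qT : q%:R <= (n * DM * q)%:R :> R.
  by rewrite ler_nat leq_pmull // muln_gt0 n1.
have : d * q%:R <= d * (n * DM * q)%:R by rewrite ler_wpM2l // ltW.
lra.
Qed.

Lemma dither_freq_bigO (R : realType) (n DM : nat) (i : 'I_n) :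
  (1 <= DM)%N ->
  (fun eps : R => dither_freq DM eps i) =O_ (0^'+) (fun eps : R => Num.sqrt eps).
Proof.
move=> DM1; have n1 : (1 <= n)%N by case: n i => // -[].
(* The frequency is [2 pi i / T] with one-based [i], and [1 / T <= 2 d] once [eps <= 1/16], that is
   [d <= 1/4]. *)
apply/eqO_exP; exists (4 * pi * i.+1%:R).
  by rewrite !mulr_gt0 ?pi_gt0 ?ltr0n.
near=> eps.
have e0 : 0 < eps by near: eps; exact: nbhs_right_gt.
have e1 : eps <= 16^-1 by near: eps; apply: nbhs_right_le; rewrite invr_gt0.
set d := Num.sqrt eps.
have d0 : 0 < d by rewrite sqrtr_gt0.
have dd : d ^+ 2 = eps by rewrite sqr_sqrtr // ltW.
have d4 : 4 * d <= 1 by nra.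
have [T [hT nT _ dT]] := dither_period_large _ _ _ _ n1 DM1 d0 d4.
rewrite dd in hT; rewrite (dither_freqE _ _ _ _ _ _ hT).
have T0 : 0 < T%:R :> R by rewrite ltr0n (leq_ltn_trans _ nT).
have p0 : 0 <= 2 * pi * i.+1%:R :> R by rewrite !mulr_ge0 ?pi_ge0.
rewrite !ger0_norm ?divr_ge0 // ?(ltW d0) // ler_pdivrMr //.
have : 2 * pi * i.+1%:R * 1 <= 2 * pi * i.+1%:R * (2 * d * T%:R).
  by rewrite ler_wpM2l.
lra.
Unshelve. all: by end_near.
Qed.

(** * The algorithm in scaled variables *)

Section trajectory.
Context (R : realType) (n : nat) (H : 'M[R]_n) (thetas : 'cV[R]_n).
Context (Qs Q0 alpha0 sigma0 : R) (DM : nat) (a : 'I_n -> R).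
Context (k lambda omegah eps : R) (D : nat -> nat).
Context (theta thetahat : nat -> 'cV[R]_n) (y eta : nat -> R).
Hypothesis traj : es_trajectory H thetas Qs Q0 alpha0 DM a k lambda omegah eps D
  theta thetahat y eta.
Hypothesis hD : forall j, (D j <= DM)%N.
Hypothesis alpha00 : 0 < alpha0.
Hypothesis b0 : 0 < 1 - eps * lambda.

Let alpha := dither_gain alpha0 lambda eps.
Let b := 1 - eps * lambda.

Definition scaled_theta j : 'cV[R]_n := (alpha j)^-1 *: (thetahat j - thetas).
(** The map is quadratic around [thetas], so output errors are measured against the square of the
    amplitude. *)
Definition scaled_eta j : R := (alpha j)^-1 ^+ 2 * (eta j - Qs).
Definition scaled_y j : R := (alpha j)^-1 ^+ 2 * (y j - Qs).
(* No dither is injected up to time [DM]; with this convention [input_error]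
   covers the transient as well. *)
Definition active_dither j : 'cV[R]_n :=
  if (j <= DM)%N then 0 else dither_S DM a eps j.

Lemma dither_gain_gt0 j : 0 < alpha j.
Proof. by rewrite /alpha /dither_gain mulr_gt0 ?exprn_gt0. Qed.

Lemma dither_gainS j : alpha j.+1 = b * alpha j.
Proof. by rewrite /alpha /dither_gain exprS mulrCA. Qed.

Lemma input_error j :
  theta j - thetas = alpha j *: (scaled_theta j + active_dither j).
Proof.
have aj := lt0r_neq0 (dither_gain_gt0 j).
rewrite /scaled_theta /active_dither scalerDr scalerA divff // scale1r.
have [jDM|DMj] := leqP j DM.
  by rewrite scaler0 addr0 (es_theta_init traj) // (es_thetahat_init traj).
by rewrite (es_theta_dither traj) // addrAC.
Qed.

Lemma scaled_y_delayed j : (DM <= j)%N -> scaled_y j =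
  2^-1 * (b ^+ (2 * D j))^-1
  * qform H (scaled_theta (j - D j)%N + active_dither (j - D j)%N).
Proof.
move=> DMj; rewrite /scaled_y (es_y_delayed traj) // /quad_map input_error.
have aj : alpha j = b ^+ D j * alpha (j - D j)%N.
  rewrite /alpha /dither_gain mulrCA -exprD subnKC //.
  by rewrite (leq_trans (hD j)).
rewrite [Qs + _]addrC addrK qformZ aj mulnC exprM; field.
by rewrite !lt0r_neq0 ?exprn_gt0 ?dither_gain_gt0.
Qed.

Lemma scaled_theta_step j : (DM <= j)%N -> scaled_theta j.+1 =
  b^-1 *: (scaled_theta j
    - (eps * k * (scaled_y j - scaled_eta j)) *: dither_M DM a eps j).
Proof.
move=> DMj; have aj := lt0r_neq0 (dither_gain_gt0 j).
rewrite /scaled_theta /scaled_y /scaled_eta (es_thetahat_step traj) //.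
rewrite -/alpha dither_gainS; move: (dither_M _ _ _ _) => Mj.
apply/matrixP => p q; rewrite !mxE; field.
by rewrite -/b aj lt0r_neq0.
Qed.

Lemma scaled_eta_step j : (DM <= j)%N -> scaled_eta j.+1 =
  (b ^+ 2)^-1 * (scaled_eta j + eps * omegah * (scaled_y j - scaled_eta j)).
Proof.
move=> DMj; have aj := lt0r_neq0 (dither_gain_gt0 j).
rewrite /scaled_y /scaled_eta (es_eta_step traj) // dither_gainS; field.
by rewrite -/b aj lt0r_neq0.
Qed.

Hypothesis eps0 : 0 < eps.
Hypothesis lambda0 : 0 < lambda.
Hypothesis small : 4 * DM%:R * lambda * eps <= 1.

Let b1 : b <= 1.
Proof. by rewrite /b gerBl mulr_ge0 // ltW. Qed.

(** Over the first [DM] steps the amplitude keeps at least half of [alpha0], so the scaled initial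
    errors are bounded independently of [eps]. *)
Lemma dither_gain_transient j : (j <= DM)%N -> (alpha j)^-1 <= 2 / alpha0.
Proof.
move=> jDM; rewrite invf_ple ?posrE ?dither_gain_gt0 ?divr_gt0 // invf_div.
rewrite /alpha /dither_gain ler_wpM2l ?(ltW alpha00) //.
have el0 : 0 <= eps * lambda by rewrite mulr_ge0 // ltW.
have le1 : 0 <= eps * lambda <= 1 by rewrite el0 /= -subr_ge0 ltW.
apply: le_trans (@bernoulli_sub R _ j le1).
have : j%:R * (eps * lambda) <= DM%:R * (eps * lambda).
  by rewrite ler_wpM2r ?ler_nat.
have : 4 * (DM%:R * (eps * lambda)) <= 1.
  by rewrite (_ : 4 * _ = 4 * DM%:R * lambda * eps) //; ring.
lra.
Qed.

Lemma scaled_theta_init j : enorm (theta 0%N - thetas) <= sigma0 ->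
  (j <= DM)%N -> qform 1%:M (scaled_theta j) <= (2 * sigma0 / alpha0) ^+ 2.
Proof.
move=> hs jDM; rewrite /scaled_theta (es_thetahat_init traj) // qformZ.
have s0 : 0 <= sigma0 by apply: le_trans hs; exact: sqrtr_ge0.
have q0 : 0 <= qform 1%:M (theta 0%N - thetas).
  by rewrite qform1E; apply: sumr_ge0 => i _; exact: sqr_ge0.
rewrite (_ : 2 * _ / _ = (2 / alpha0) * sigma0); last by rewrite mulrAC.
rewrite exprMn; apply: ler_pM => //; first exact: sqr_ge0.
  by rewrite ler_sqr ?nnegrE ?divr_ge0 ?invr_ge0 ?dither_gain_transient //
    ltW ?dither_gain_gt0.
rewrite -(sqr_sqrtr q0) -enormE ler_sqr ?nnegrE //; exact: sqrtr_ge0.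
Qed.

Lemma scaled_eta_init : `|scaled_eta DM| <= (2 / alpha0) ^+ 2 * `|Q0 - Qs|.
Proof.
rewrite /scaled_eta (es_eta_init traj) normrM ler_wpM2r //.
by rewrite ger0_norm ?sqr_ge0 // ler_sqr ?nnegrE ?divr_ge0 ?invr_ge0
  ?dither_gain_transient // ltW ?dither_gain_gt0.
Qed.

Lemma active_dither_step j : (DM < j)%N -> active_dither j = dither_S DM a eps j.
Proof. by rewrite ltnNge /active_dither; case: leqP. Qed.

Lemma active_dither_le j : (forall i, 0 < a i) ->
  `|active_dither j| <= \sum_i a i.
Proof.
move=> ha; rewrite /active_dither; case: ifP => _; last exact: dither_S_le.
by rewrite normr0; apply: sumr_ge0 => i _; exact: ltW.
Qed.

(** Undoing the scaling restores [b^j] for the estimate and [b^(2 j)] for [eta]; the latter is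
    weakened to [b^j] to have a common rate. *)
Lemma unscaled_decay (r X : R) j : 0 <= r -> 0 <= X ->
  qform 1%:M (scaled_theta j) <= r ^+ 2 -> `|scaled_eta j| <= X ->
  enorm (thetahat j - thetas) <= alpha0 * r * b ^+ j /\
  `|eta j - Qs| <= alpha0 ^+ 2 * X * b ^+ j.
Proof.
move=> r0 X0 zr xX; have aj := dither_gain_gt0 j.
have bj : 0 <= b ^+ j <= 1 by rewrite exprn_ge0 ?exprn_ile1 // ltW.
split.
  have -> : thetahat j - thetas = alpha j *: scaled_theta j.
    by rewrite scalerA divff ?scale1r // lt0r_neq0.
  rewrite enormE qformZ sqrtrM ?sqr_ge0 // sqrtr_sqr gtr0_norm //.
  rewrite [leRHS]mulrAC; apply: (ler_wpM2l (ltW aj)).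
  by rewrite -[leRHS]ger0_norm // -sqrtr_sqr ler_wsqrtr.
have -> : eta j - Qs = alpha j ^+ 2 * scaled_eta j.
  by rewrite /scaled_eta mulrA -exprMn divff ?expr1n ?mul1r // lt0r_neq0.
rewrite normrM ger0_norm ?sqr_ge0 // [leRHS]mulrAC ler_pM ?sqr_ge0 //.
rewrite /alpha /dither_gain exprMn ler_wpM2l ?sqr_ge0 // expr2.
by case/andP: bj => bj0 bj1; rewrite ler_piMr.
Qed.

End trajectory.

Arguments scaled_theta {R n} thetas alpha0 lambda eps thetahat j.
Arguments scaled_eta {R} Qs alpha0 lambda eps eta j.
Arguments scaled_y {R} Qs alpha0 lambda eps y j.
Arguments active_dither {R n} DM a eps j.

(** * Choice of the constants and conclusion *)

Theorem corollary1 (R : realType) (n : nat) (hn : (1 <= n)%N)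
    (H : 'M[R]_n) (hH : posdef H) (thetas : 'cV[R]_n) (Qs Q0 alpha0 : R)
    (halpha0 : 0 < alpha0) (sigma0 : R) (hsigma0 : 0 < sigma0)
    (DM : nat) (hDM : (1 <= DM)%N) (a : 'I_n -> R) (ha : forall i, 0 < a i)
    (k lambda omegah : R) (hk : 0 < k) (hlambda : 0 < lambda)
    (homegah : 0 < omegah)
    (hkH : mx_gt (k *: H) (lambda *: 1%:M)) (homegah2 : 2 * lambda < omegah) :
  (forall i : 'I_n,
     (fun eps : R => dither_freq DM eps i) =O_ (0^'+) (fun eps : R => Num.sqrt eps))
  /\
  exists2 epss : R, 0 < epss &
    forall eps : R, 0 < eps <= epss ->
      es_exponentially_stable H thetas Qs Q0 alpha0 sigma0 DM a
        k lambda omegah eps.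
Proof.
split=> [i|]; first exact: dither_freq_bigO.
have [mu mu0 Pmu] := posdef_coercive _ _ _ hkH.
(* This radius bounds the scaled initial error uniformly in [eps], by [scaled_theta_init]. *)
pose rho := 2 * sigma0 / alpha0.
pose G := mxl1 H * (rho + 1 + \sum_i a i) ^+ 2.
(* The first summand covers the initial value of [scaled_eta]; the second yields [GX], hence the
   invariance in [xi_next]. As [G] does not involve [X], the choice is not circular. *)
pose X := (2 / alpha0) ^+ 2 * `|Q0 - Qs| + omegah * G / (omegah - 2 * lambda).
have rho0 : 0 <= rho by rewrite divr_ge0 ?mulr_ge0 // ltW.
have G0 : 0 <= G by rewrite mulr_ge0 ?mxl1_ge0 ?sqr_ge0.
have ol : 0 < omegah - 2 * lambda by rewrite subr_gt0.
have X1 : 0 <= omegah * G / (omegah - 2 * lambda).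
  by rewrite divr_ge0 ?(ltW ol) // mulr_ge0 // ltW.
have X2 : 0 <= (2 / alpha0) ^+ 2 * `|Q0 - Qs| by rewrite mulr_ge0 ?sqr_ge0.
have X0 : 0 <= X by rewrite addr_ge0.
have GX : omegah * G <= (omegah - 2 * lambda) * X.
  rewrite -ler_pdivrMl // mulrC lerDr //.
pose kappa := smallness_threshold H DM a k lambda omegah rho X mu.
have kappa4 : 4 <= kappa by apply: smallness_threshold_ge4.
have kappa0 : 0 < kappa by apply: lt_le_trans kappa4.
(* This is the bound on [eps] that amounts to [kappa * d <= 1] for [d = sqrt eps]. *)
exists (kappa^-1 ^+ 2) => [|eps /andP[eps0 epsk]].
  by rewrite exprn_gt0 // invr_gt0.
pose d := Num.sqrt eps.
have d0 : 0 < d by rewrite sqrtr_gt0.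
have epsE : eps = d ^+ 2 by rewrite sqr_sqrtr // ltW.
have kd : kappa * d <= 1.
  rewrite -ler_pdivlMl // mulr1.
  rewrite -ler_sqr ?nnegrE ?(ltW d0) ?invr_ge0 ?(ltW kappa0) //.
  by rewrite -epsE.
have d4 : 4 * d <= 1 by apply: le_trans kd; rewrite ler_wpM2r // ltW.
have [T [hT nT dT1 dT2]] := dither_period_large _ n DM d hn hDM d0 d4.
rewrite -epsE in hT.
have eps_d : eps <= d by rewrite epsE expr2 ler_piMr ?(ltW d0) //; lra.
have small : 4 * DM%:R * lambda * eps <= 1.
  have kl : 4 * DM%:R * lambda <= kappa by apply: smallness_threshold_gain.
  apply: le_trans kd; apply: ler_pM => //; last exact: ltW.
  by rewrite !mulr_ge0 // ltW.
have el : 4 * (eps * lambda) <= 1.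
  apply: le_trans small; rewrite [eps * _]mulrC mulrA ler_wpM2r ?(ltW eps0) //.
  by rewrite ler_wpM2r ?(ltW hlambda) // ler_peMr // ler1n.
have el0 : 0 < eps * lambda by rewrite mulr_gt0.
have b0 : 0 < 1 - eps * lambda by lra.
(* The rate is that of the dither amplitude; the constant adds those of the two errors in
   [unscaled_decay]. *)
exists (alpha0 * (rho + 1) + alpha0 ^+ 2 * X), (1 - eps * lambda).
have c1 : 0 < alpha0 * (rho + 1) by rewrite mulr_gt0 // ltr_wpDl.
have c2 : 0 <= alpha0 ^+ 2 * X by rewrite mulr_ge0 ?sqr_ge0.
split; [by rewrite ltr_wpDr | by apply/andP; split; lra |].
move=> D theta thetahat y eta hD traj hs thetat etat j DMj.
have xi0 : `|scaled_eta Qs alpha0 lambda eps eta DM| <= X.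
  apply: le_trans (_ : (2 / alpha0) ^+ 2 * `|Q0 - Qs| <= _); last by rewrite lerDl.
  exact: (scaled_eta_init _ _ _ _ _ _ _ _ _ _ _ _ _ _ _ _ _ _ traj).
have [] := scaled_error_bounded R n H DM a k lambda omegah rho X mu
  ha hk hlambda homegah2 rho0 X0 mu0 T eps d D
  (scaled_theta thetas alpha0 lambda eps thetahat) (active_dither DM a eps)
  (scaled_eta Qs alpha0 lambda eps eta) (scaled_y Qs alpha0 lambda eps y)
  hH.1 hDM epsE d0 kd hD hT nT dT1 dT2 _ _ _ _ _ _ xi0 GX Pmu j.
- by move=> i; apply: scaled_y_delayed hD halpha0 b0 _; exact: traj.
- by move=> i; apply: scaled_theta_step halpha0 b0 _; exact: traj.
- by move=> i; apply: scaled_eta_step halpha0 b0 _; exact: traj.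
- exact: active_dither_step.
- by move=> i; exact: active_dither_le.
- by move=> i; apply: scaled_theta_init small i hs => //; exact: traj.
move=> /(_ j (leqnn j)) zj /(_ j); rewrite DMj leqnn => /(_ isT) xj.
have r0 : 0 <= rho + 1 by rewrite addr_ge0.
have [zd xd] := unscaled_decay _ _ _ _ _ _ _ _ _ halpha0 b0 eps0 hlambda
  _ _ _ r0 X0 zj xj.
have bj : 0 <= (1 - eps * lambda) ^+ j by rewrite exprn_ge0 // ltW.
split; [apply: le_trans zd _|apply: le_trans xd _]; rewrite ler_wpM2r //.
  by rewrite lerDl.
by rewrite lerDr ltW.
Qed.
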